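(* For an integral domain $D$ the following are equivalent: (i) $D$ is a valuation domain; (ii) $D$ is an integrally closed coherent $t$-local domain; (iii) $D$ is an integrally closed finite conductor $t$-local domain.
   Context: Let $K$ be the quotient field of $D$. For a nonzero fractional ideal $E$ of $D$ put $E^{-1}=\{x\in K: xE\subseteq D\}$, $E^v=(E^{-1})^{-1}$, and $E^t=\bigcup\{F^v : F\subseteq E,\ F \text{ a nonzero finitely generated ideal}\}$; by convention $(0)^v=(0)^t=(0)$. $E$ is a $t$-ideal if $E=E^t$. ''Local'' means having exactly one maximal ideal (not necessarily Noetherian). An integral domain is $t$-local if it is local and its maximal ideal is a $t$-ideal (so a field is $t$-local). A ring is coherent if every finitely generated ideal is finitely presented. $D$ is a finite conductor (FC) domain if the intersection of every pair of principal ideals of $D$ is finitely generated. Fields are counted as valuation domains. *)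

(* Defs.v *)
From HB Require Import structures.
From mathcomp Require Import all_boot all_order all_algebra.
From mathcomp Require Import boolp classical_sets.
Set Implicit Arguments.
Unset Strict Implicit.
Unset Printing Implicit Defensive.
Import GRing.Theory.
Local Open Scope classical_set_scope.
Local Open Scope ring_scope.

Definition fg_submodule (R : pzRingType) (V : lmodType R) (N : set V) : Prop :=
  exists s : seq V,
    N = [set v | exists c : nat -> R, v = \sum_(i < size s) c i *: s`_i].

(* N is the quotient of a finite free module R^n by a finitely generated
   module of relations. *)
Definition fp_submodule (R : nzRingType) (V : lmodType R) (N : set V) : Prop :=
  exists (n : nat) (f : {linear 'rV[R]_n -> V}),
    range f = N /\ fg_submodule (f @^-1` [set 0]).

Definition fg_ideal (R : nzRingType) (I : set R) : Prop :=
  @fg_submodule R R^o I.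

Definition coherent (R : nzRingType) : Prop :=
  forall I : set R, fg_ideal I -> @fp_submodule R R^o I.

Definition principal (R : comNzRingType) (a : R) : set R :=
  [set r * a | r in setT].

Definition finite_conductor (D : idomainType) : Prop :=
  forall a b : D, fg_ideal (principal a `&` principal b).

(* idealr_closed requires the ideal to be proper. *)
Definition maximal_ideal (R : comNzRingType) (M : set R) : Prop :=
  idealr_closed (mem M) /\
  forall I : set R, idealr_closed (mem I) -> M `<=` I -> I = M.

Definition local (R : comNzRingType) : Prop :=
  exists! M : set R, maximal_ideal M.

Definition integrally_closed (D : idomainType) : Prop :=
  forall x : {fraction D}, integralOver (@tofrac D) x -> range (@tofrac D) x.

Definition valuation_domain (D : idomainType) : Prop :=
  forall x : {fraction D}, x != 0 ->
    range (@tofrac D) x \/ range (@tofrac D) x^-1.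

(* The operations below are defined on all subsets of the quotient field, but
   carry their usual meaning only on fractional ideals. *)
Definition frac_inverse (D : idomainType) (E : set {fraction D}) :
    set {fraction D} :=
  [set x | forall y, E y -> range (@tofrac D) (x * y)].

Definition v_closure (D : idomainType) (E : set {fraction D}) :
    set {fraction D} :=
  if `[< E = [set 0] >] then [set 0] else frac_inverse (frac_inverse E).

(* Finitely generated D-submodules of the quotient field; stated separately
   from fg_submodule as {fraction D} has no canonical D-module structure. *)
Definition fg_fractional (D : idomainType) (F : set {fraction D}) : Prop :=
  exists s : seq {fraction D},
    F = [set x | exists c : nat -> D,
           x = \sum_(i < size s) tofrac (c i) * s`_i].

Definition t_closure (D : idomainType) (E : set {fraction D}) :
    set {fraction D} :=
  if `[< E = [set 0] >] then [set 0] else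
  \bigcup_(F in [set F | [/\ F `<=` E, F <> [set 0] & fg_fractional F]])
    v_closure F.

Definition t_ideal (D : idomainType) (E : set {fraction D}) : Prop :=
  E = t_closure E.

Definition t_local (D : idomainType) : Prop :=
  local D /\ forall M : set D, maximal_ideal M -> t_ideal (@tofrac D @` M).

(* Main.v *)
Require Import Defs.
From HB Require Import structures.
From mathcomp Require Import all_boot all_order all_algebra.
From mathcomp Require Import boolp classical_sets.
From mathcomp Require Import ring.

Set Implicit Arguments.
Unset Strict Implicit.
Unset Printing Implicit Defensive.
Import GRing.Theory.
Local Open Scope classical_set_scope.
Local Open Scope ring_scope.

(** Write K for the fraction field of D.

    Valuation domains satisfy the other conditions: if x is integral and x^-1
    lies in D, the integral equation expresses x as a polynomial in x^-1.
    Divisibility is a total preorder on K, so every finitely generated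
    D-submodule of K is generated by 0 or by one of its given generators
    ([valuation_fg_fractional]).  Hence finitely generated ideals are
    principal, and a principal ideal is finitely presented; the nonunits form
    an ideal, which is then the only maximal one; and since (yD)^v = yD, every
    proper ideal is a t-ideal ([valuation_t_ideal]).

    Coherent domains are finite conductor: aD meet bD is the image of the
    syzygies of (a, b) under the first coordinate times a, and by Schanuel's
    argument the syzygies of the generators a, b are finitely generated as soon
    as those of some other finite generating family of (a, b) are
    ([coherent_cap_principal_fg]).

    In an integrally closed finite conductor t-local domain D, let a, b be
    nonzero and let s generate L = aD meet bD.
    As (a, b)^-1 = (ab)^-1 L, the product J = (a, b)(a, b)^-1 is generated by
    the x/a and x/b for x in s.  An element y of J^-1 satisfies y L <= L, so it
    is integral over D by the determinant trick and lies in D; thus J^-1 = D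
    and J^v = D ([cap_principal_stable]).  If neither of a, b divided the
    other, no x/a or x/b would be a unit, so J would lie in the maximal ideal
    M, and M being a t-ideal would contain J^v = D
    ([finite_conductor_t_local_dvd]). *)

Local Notation "x %:F" := (@tofrac _ x).

(** * Proper ideals and nonunits *)

Lemma idealr_closedP (R : nzRingType) (I : set R) :
  idealr_closed (mem I) <->
  [/\ I 0, ~ I 1 & forall a u v, I u -> I v -> I (a * u + v)].
Proof.
split=> [[I0 I1 Iadd]|[I0 I1 Iadd]]; split.
- exact: set_mem I0.
- by move=> /mem_set I1'; move/negP: I1; apply.
- by move=> a u v /mem_set Iu /mem_set Iv; apply: set_mem; apply: Iadd.
- exact: mem_set.
- by apply/negP => /set_mem.
- by move=> a u v /set_mem Iu /set_mem Iv; apply: mem_set; apply: Iadd.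
Qed.

Lemma ideal_mul (R : nzRingType) (I : set R) a u :
  idealr_closed (mem I) -> I u -> I (a * u).
Proof.
by move=> /idealr_closedP[I0 _ Iadd] Iu; rewrite -[_ * _]addr0; apply: Iadd.
Qed.

Lemma ideal_nonunit (R : comUnitRingType) (I : set R) u :
  idealr_closed (mem I) -> I u -> u \isn't a GRing.unit.
Proof.
move=> idI Iu; apply/negP => uU.
have [_ I1 _] := (idealr_closedP I).1 idI.
by apply: I1; rewrite -(mulVr uU); apply: ideal_mul.
Qed.

(** Krull's theorem for a principal ideal.  The empty set is admitted in the
    family to which Zorn's lemma is applied because the union of the empty
    chain is empty; it is never maximal, being below the principal ideal. *)
Lemma nonunit_in_maximal_ideal (R : comUnitRingType) (x : R) :
  x \isn't a GRing.unit -> exists2 M : set R, maximal_ideal M & M x.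
Proof.
move=> xNU.
pose P : set (set R) := [set I | I = set0 \/ (idealr_closed (mem I) /\ I x)].
have [F FP Ftot|M [PM Mmax]] := @Zorn_bigcup _ P.
  have [[I0 [FI0 I0x]]|noI] := pselect (exists I, F I /\ I x); last first.
    left; apply/seteqP; split=> // y [I FI Iy].
    have [I0|[_ Ix]] := FP _ FI; first by move: Iy; rewrite I0.
    by case: noI; exists I.
  have idF I y : F I -> I y -> idealr_closed (mem I).
    by move=> FI Iy; have [Ie|[]//] := FP _ FI; move: Iy; rewrite Ie.
  right; split; last by exists I0.
  apply/idealr_closedP; split.
  - by exists I0 => //; have [] := (idealr_closedP _).1 (idF _ _ FI0 I0x).
  - by move=> [I FI I1]; have [] := (idealr_closedP _).1 (idF _ _ FI I1).
  - move=> a u v [I FI Iu] [J FJ Jv].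
    have [IJ|JI] := Ftot _ _ FI FJ.
      exists J => //; have [_ _] := (idealr_closedP _).1 (idF _ _ FJ Jv).
      by apply=> //; apply: IJ.
    exists I => //; have [_ _] := (idealr_closedP _).1 (idF _ _ FI Iu).
    by apply=> //; apply: JI.
have idx : idealr_closed (mem (principal x)).
  apply/idealr_closedP; split; first by exists 0; rewrite ?mul0r.
  - move=> [r _ rx]; move/negP: xNU; apply.
    by apply/unitrPr; exists r; rewrite mulrC.
  - move=> a u v [r _ <-] [s _ <-]; exists (a * r + s) => //.
    by rewrite mulrDl mulrA.
have xx : principal x x by exists 1; rewrite ?mul1r.
case: PM => [M0|[idM Mx]].
  case: (Mmax (principal x)); last by right.
  by rewrite M0; split=> // /(_ _ xx).
exists M => //; split=> // I idI MI.
apply: contrapT => IM; apply: (Mmax I); last by right; split=> //; apply: MI.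
by split=> // IM'; apply: IM; apply/seteqP.
Qed.

Lemma local_nonunit (R : comUnitRingType) (M : set R) x :
  local R -> maximal_ideal M -> x \isn't a GRing.unit -> M x.
Proof.
move=> [M0 [_ uniqM]] maxM /nonunit_in_maximal_ideal[N maxN Nx].
by rewrite -(uniqM M maxM) (uniqM N maxN).
Qed.

(** * Finite linear combinations *)

Lemma sum_delta (R : pzRingType) (V : lmodType R) (s : seq V) i :
  (i < size s)%N -> s`_i = \sum_(j < size s) (j == i :> nat)%:R *: s`_j.
Proof.
move=> si; rewrite (bigD1 (Ordinal si)) //= eqxx scale1r big1 ?addr0 // => j ji.
by rewrite -val_eqE /= in ji; rewrite (negbTE ji) scale0r.
Qed.

Lemma fg_ideal_combE (R : nzRingType) (I : set R) :
  fg_ideal I -> exists s : seq R,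
  I = [set z | exists c : nat -> R, z = \sum_(i < size s) c i * s`_i].
Proof. by []. Qed.

Lemma principal_sum (R : comNzRingType) (a : R) n (c F : 'I_n -> R) :
  (forall i, principal a (F i)) -> principal a (\sum_i c i * F i).
Proof.
move=> aF; apply: big_ind => [|x y [r _ <-] [q _ <-]|i _].
- by exists 0; rewrite ?mul0r.
- by exists (r + q); rewrite ?mulrDl.
- by have [r _ <-] := aF i; exists (c i * r); rewrite ?mulrA.
Qed.

Definition comb (R : comNzRingType) (V : lmodType R) n (w : 'I_n -> V)
  (k : 'rV[R]_n) : V := \sum_i k 0 i *: w i.

Lemma comb_is_linear (R : comNzRingType) (V : lmodType R) n (w : 'I_n -> V) :
  linear (comb w).
Proof.
move=> a u v; rewrite /comb scaler_sumr -big_split /=.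
by apply: eq_bigr => i _; rewrite !mxE scalerDl scalerA.
Qed.

HB.instance Definition _ (R : comNzRingType) (V : lmodType R) n (w : 'I_n -> V) :=
  GRing.isLinear.Build R 'rV[R]_n V _ (comb w) (comb_is_linear w).

(** * Coherent rings are finite conductor *)

(** Let f : R^n -> (a, b) be a finite presentation, with f(e_i) = c_i a + d_i b
    and h(k) = a * sum of the k_i c_i.  Then h(k) lies in aR and f(k) - h(k) in
    bR, so h maps ker f into the intersection.  With f(u) = a and f(v) = b, an
    element z = r a = s b of the intersection satisfies ru - sv in ker f and
    z = h(ru - sv) + r (a - h(u)) + s h(v); hence a - h(u), h(v) and the images
    under h of generators of ker f generate the intersection. *)
Lemma coherent_cap_principal_fg (R : comNzRingType) (a b : R) :
  coherent R -> fg_ideal (principal a `&` principal b).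
Proof.
move=> coh.
have [n [f [imf [t kert]]]] : @fp_submodule R R^o [set v : R |
    exists c : nat -> R, v = \sum_(i < 2) c i *: ([:: a; b] : seq R^o)`_i].
  by apply: coh; exists [:: a; b].
have imfP z : (exists k, f k = z) <-> exists c d : R, z = c * a + d * b.
  have <- : (range f z) <-> exists k, f k = z.
    by split=> [[k _]|[k]]; exists k.
  rewrite imf; split=> [[c ->]|[c [d ->]]].
    by exists (c 0%N), (c 1%N); rewrite big_ord_recl big_ord1.
  by exists (fun i => if i is 0%N then c else d); rewrite big_ord_recl big_ord1.
have [u fu] : exists k, f k = a.
  by apply/imfP; exists 1, 0; rewrite mul1r mul0r addr0.
have [v fv] : exists k, f k = b.
  by apply/imfP; exists 0, 1; rewrite mul1r mul0r add0r.
have fe i := (imfP (f (delta_mx 0 i))).1 (ex_intro _ _ erefl).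
have [c /choice[d cdE]] := choice fe.
pose h : {linear 'rV[R]_n -> R^o} := @comb R R^o n (fun i => c i * a).
have hP k : principal a (h k) /\ principal b (f k - h k).
  split; first by apply: principal_sum => i; exists (c i).
  have -> : f k - h k = \sum_i k 0 i * (d i * b).
    rewrite {1}(row_sum_delta k) linear_sum /h /= /comb -sumrB.
    apply: eq_bigr => i _.
    by rewrite linearZ /= cdE /GRing.scale /= mulrDr addrAC subrr add0r.
  by apply: principal_sum => i; exists (d i).
exists [:: a - h u, h v & [seq h k | k <- t]].
apply/seteqP; split=> z.
  move=> [[r _ ra] [s _ sb]].
  have : (f @^-1` [set 0]) (r *: u - s *: v).
    rewrite /preimage /= linearB !linearZ /= fu fv.
    by rewrite /GRing.scale /= mulrN ra sb subrr.
  rewrite kert => -[e eE].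
  exists (fun i => if i is j.+1 then (if j is l.+1 then e l else s) else r).
  rewrite /= 2!big_ord_recl /= size_map.
  have -> : \sum_(i < size t) e i *: (map h t)`_i = h (r *: u - s *: v).
    rewrite eE linear_sum; apply: eq_bigr => i _.
    by rewrite linearZ /= (nth_map 0).
  have -> : h (r *: u - s *: v) = r * h u - s * h v.
    by rewrite linearB !linearZ.
  rewrite -ra -[r *: _]/(r * _) -[s *: _]/(s * _).
  have split_ra (p q : R) :
    r * a = r * (a - p) + (s * q + (r * p - s * q)) by ring.
  exact: split_ra.
move=> [e ->].
have gP i : (i < (size t).+2)%N ->
    let g := [:: a - h u, h v & [seq h k | k <- t]]`_i in
    principal a g /\ principal b g.
  case: i => [_|[_|i it]] /=.
  - have [[q _ qa]] := hP u; rewrite fu; split=> //.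
    by exists (1 - q); rewrite // mulrBl mul1r qa.
  - have [hva [q _ qb]] := hP v; split=> //.
    by exists (1 - q) => //; rewrite mulrBl mul1r qb fv; apply: subKr.
  - rewrite (nth_map 0) //.
    have [hka [q _ qb]] := hP t`_i; split=> //.
    have : (f @^-1` [set 0]) t`_i.
      by rewrite kert; exists (fun j => (j == i)%:R); apply: sum_delta.
    rewrite /preimage /= => fk; exists (- q) => //.
    by rewrite mulNr qb fk sub0r opprK.
by split; apply: principal_sum => -[i /=]; rewrite size_map => /gP[].
Qed.

(** * Integrally closed finite conductor t-local domains are valuation domains *)

Lemma fracP (D : idomainType) (x : {fraction D}) :
  exists2 ab : D * D, ab.2 != 0 & x = ab.1%:F / ab.2%:F.
Proof.
elim/quotW: x => r; exists (val r); first exact: denom_ratioP.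
unlock tofrac; rewrite -[X in _ * X]FracField.pi_inv -[RHS]FracField.pi_mul.
rewrite /FracField.mulf /FracField.invf.
rewrite !numden_Ratio ?oner_neq0 ?denom_ratioP //.
by rewrite mulr1 mul1r Ratio_numden.
Qed.

(** Determinant trick: the generators form a nonzero eigenvector, for the
    eigenvalue x, of a matrix with entries in D, so x is a root of the
    characteristic polynomial of that matrix. *)
Lemma integral_of_fg_stable (D : comNzRingType) (K : fieldType)
    (f : {rmorphism D -> K}) (x : K) (s : seq K) :
  (exists2 y, y \in s & y != 0) ->
  (forall i, (i < size s)%N -> exists c : nat -> D,
     x * s`_i = \sum_(j < size s) f (c j) * s`_j) ->
  integralOver f x.
Proof.
move=> [y ys y0] stab.
have [C HC] := choice (fun i : 'I_(size s) => stab i (ltn_ord i)).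
pose A : 'M[D]_(size s) := \matrix_(i, j) C j i.
exists (char_poly A); first exact: char_poly_monic.
rewrite map_char_poly -eigenvalue_root_char; apply/eigenvalueP.
exists (\row_j s`_j).
  apply/rowP => j; rewrite !mxE HC; apply: eq_bigr => i _.
  by rewrite !mxE mulrC.
apply: contra_neq y0 => /rowP s0.
have := s0 (Ordinal (etrans (index_mem y s) ys)).
by rewrite !mxE /= nth_index.
Qed.

(** The hypothesis on y says that it lies in the inverse of
    (a, b)(a, b)^-1; it then multiplies the intersection into itself. *)
Lemma cap_principal_stable (D : idomainType) (a b : D) (s : seq D)
    (y : {fraction D}) :
  integrally_closed D -> a != 0 -> b != 0 ->
  principal a `&` principal b =
    [set z | exists c : nat -> D, z = \sum_(i < size s) c i * s`_i] ->
  (forall x, x \in s -> range (@tofrac D) (y * (x%:F / a%:F)) /\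
                        range (@tofrac D) (y * (x%:F / b%:F))) ->
  range (@tofrac D) y.
Proof.
move=> icD a0 b0 capE yP; apply: icD.
apply: (@integral_of_fg_stable _ _ _ _ [seq z%:F | z <- s]).
  have [x xs x0] : exists2 x, x \in s & x != 0.
    (* the intersection contains a * b, so its generators are not all zero *)
    apply: contrapT => s0.
    have : (principal a `&` principal b) (a * b).
      by split; [exists b; rewrite // mulrC | exists a].
    rewrite capE => -[c]; rewrite big1 => [/eqP|i _].
      by rewrite mulf_eq0 (negbTE a0) (negbTE b0).
    have [->|si0] := eqVneq s`_i 0; first by rewrite mulr0.
    by case: s0; exists s`_i; rewrite ?mem_nth.
  by exists x%:F; rewrite ?map_f ?tofrac_eq0.
rewrite size_map => i si.
have [[u _ ua] [v _ vb]] := yP _ (mem_nth 0 si).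
have yua : y * (s`_i)%:F = (u * a)%:F.
  by rewrite tofracM ua -mulrA divfK ?tofrac_eq0.
have yvb : y * (s`_i)%:F = (v * b)%:F.
  by rewrite tofracM vb -mulrA divfK ?tofrac_eq0.
have : (principal a `&` principal b) (u * a).
  split; first by exists u.
  by exists v => //; apply/eqP; rewrite -tofrac_eq -yua -yvb.
rewrite capE => -[c uaE].
exists c; rewrite (nth_map 0) // yua uaE rmorph_sum.
by apply: eq_bigr => j _; rewrite /= tofracM (nth_map 0).
Qed.

(** A finitely generated J inside M with J^-1 = D has J^v = D, and J^v lies in
    the t-closure of M. *)
Lemma t_closure_one (D : idomainType) (M : set D) (t : seq {fraction D}) :
  idealr_closed (mem M) ->
  (forall x, x \in t -> (@tofrac D @` M) x) ->
  (exists2 x, x \in t & x != 0) ->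
  (forall y, (forall x, x \in t -> range (@tofrac D) (y * x)) ->
     range (@tofrac D) y) ->
  t_closure (@tofrac D @` M) 1.
Proof.
move=> idM tM [x0 x0t x0n0] tinv.
pose J := [set x | exists c : nat -> D, x = \sum_(i < size t) (c i)%:F * t`_i].
have genJ x : x \in t -> J x.
  move=> xt; have it : (index x t < size t)%N by rewrite index_mem.
  exists (fun j => (j == index x t)%:R).
  rewrite -{1}(nth_index 0 xt) (@sum_delta _ {fraction D}^o t _ it).
  by apply: eq_bigr => j _; rewrite rmorph_nat.
have [M0 _ Madd] := (idealr_closedP M).1 idM.
have JM : J `<=` @tofrac D @` M.
  move=> _ [c ->]; apply: big_ind => [|x y [u Mu <-] [v Mv <-]|i _].
  - by exists 0; rewrite ?tofrac0.
  - by exists (1 * u + v); [apply: Madd | rewrite mul1r tofracD].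
  - have [u Mu <-] := tM _ (mem_nth 0 (ltn_ord i)).
    by exists (c i * u); rewrite ?tofracM //; apply: ideal_mul.
have n0 (E : set {fraction D}) : E x0 -> E <> [set 0].
  by move=> Ex0 E0; move: Ex0; rewrite E0 => /eqP; rewrite (negbTE x0n0).
rewrite /t_closure asboolF; last by apply: n0; apply: tM.
have Jn0 : J <> [set 0] by apply: n0; apply: genJ.
exists J; first by split=> //; exists t.
rewrite /v_closure asboolF // => y yJ; rewrite mul1r; apply: tinv => x xt.
exact/yJ/genJ.
Qed.

Lemma finite_conductor_t_local_dvd (D : idomainType) (a b : D) :
  integrally_closed D -> finite_conductor D -> t_local D ->
  a != 0 -> b != 0 ->
  range (@tofrac D) (a%:F / b%:F) \/ range (@tofrac D) (b%:F / a%:F).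
Proof.
move=> icD fcD [locD tM] a0 b0.
have [M [maxM _]] := locD.
have aF0 : a%:F != 0 by rewrite tofrac_eq0.
have bF0 : b%:F != 0 by rewrite tofrac_eq0.
apply: contrapT => /not_orP[Nab Nba].
have [s capE] := fg_ideal_combE (fcD a b).
have memL x : x \in s -> (principal a `&` principal b) x.
  move=> xs; have si : (index x s < size s)%N by rewrite index_mem.
  rewrite -(nth_index 0 xs) capE; exists (fun j => (j == index x s)%:R).
  exact: (@sum_delta D D^o).
(* x = r a = q b: a unit r or q would make one of a, b divide the other *)
have inM x : x \in s ->
    (@tofrac D @` M) (x%:F / a%:F) /\ (@tofrac D @` M) (x%:F / b%:F).
  move=> /memL[[r _ ra] [q _ qb]].
  have raqb : r%:F * a%:F = q%:F * b%:F by rewrite -!tofracM ra qb.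
  split.
    exists r; last by rewrite -ra tofracM mulfK.
    apply: local_nonunit => //; apply/negP => rU; apply: Nab.
    exists (r^-1 * q) => //; apply: (canRL (mulfK bF0)).
    by rewrite tofracM -mulrA -raqb mulrA -tofracM mulVr // tofrac1 mul1r.
  exists q; last by rewrite -qb tofracM mulfK.
  apply: local_nonunit => //; apply/negP => qU; apply: Nba.
  exists (q^-1 * r) => //; apply: (canRL (mulfK aF0)).
  by rewrite tofracM -mulrA raqb mulrA -tofracM mulVr // tofrac1 mul1r.
pose t := [seq x%:F / a%:F | x <- s] ++ [seq x%:F / b%:F | x <- s].
have ta x : x \in s -> x%:F / a%:F \in t.
  move=> xs; rewrite mem_cat; apply/orP; left.
  exact: (map_f (fun z => z%:F / a%:F)).
have tb x : x \in s -> x%:F / b%:F \in t.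
  move=> xs; rewrite mem_cat; apply/orP; right.
  exact: (map_f (fun z => z%:F / b%:F)).
have tinv y : (forall x, x \in t -> range (@tofrac D) (y * x)) ->
    range (@tofrac D) y.
  move=> yt; apply: (cap_principal_stable icD a0 b0 capE) => x xs.
  by split; apply: yt; [apply: ta | apply: tb].
suff : (@tofrac D @` M) 1.
  move=> [u Mu /eqP]; rewrite -tofrac1 tofrac_eq => /eqP u1.
  by have := ideal_nonunit maxM.1 Mu; rewrite u1 unitr1.
rewrite (tM M maxM); apply: (t_closure_one (t := t)) => //; first exact: maxM.1.
  by move=> z; rewrite mem_cat => /orP[] /mapP[x /inM[xa xb] ->].
apply: contrapT => t0.
(* if every generator vanished, tinv would put a / b in D *)
apply: Nab; apply: tinv => x xt.
have [->|x0] := eqVneq x 0; first by exists 0; rewrite // tofrac0 mulr0.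
by case: t0; exists x.
Qed.

Lemma finite_conductor_t_local_valuation (D : idomainType) :
  integrally_closed D -> finite_conductor D -> t_local D -> valuation_domain D.
Proof.
move=> icD fcD tD x; have [[a b] /= b0 ->] := fracP x => x0.
have a0 : a != 0 by apply: contra_neq x0 => ->; rewrite tofrac0 mul0r.
by rewrite invf_div; apply: finite_conductor_t_local_dvd.
Qed.

(** * Valuation domains are integrally closed *)

(** If y = x^-1 is in D, dividing the integral equation of degree n by
    x^(n-1) expresses x as a polynomial in y. *)
Lemma valuation_integrally_closed (D : idomainType) :
  valuation_domain D -> integrally_closed D.
Proof.
move=> vD x [p p_monic /rootP px0].
have [x0|x0] := eqVneq x 0; first by exists 0; rewrite // x0 tofrac0.
have [//|[y _ yx]] := vD x x0.
have pn0 : (0 < size p)%N by rewrite size_poly_gt0 monic_neq0.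
pose n := (size p).-1.
exists (- \sum_(i < n) p`_i * y ^+ (n.-1 - i)) => //.
have [n0|n_gt0] := posnP n.
  have p1 : p = 1.
    have p1 : (size p <= 1)%N by rewrite -(prednK pn0) -/n n0.
    by move/monicP: p_monic; rewrite (size1_polyC p1) lead_coefC => ->.
  by move: px0 => /eqP; rewrite p1 rmorph1 hornerE oner_eq0.
move: px0; rewrite horner_coef size_map_inj_poly ?rmorph0 //; last first.
  by move=> a b /eqP; rewrite tofrac_eq => /eqP.
rewrite -[size p](prednK pn0) -/n big_ord_recr /=.
have -> : (map_poly (@tofrac D) p)`_n = 1.
  by rewrite coef_map /= -lead_coefE (monicP p_monic) rmorph1.
rewrite mul1r => /eqP; rewrite addrC addr_eq0 => /eqP xn.
apply: (@mulfI _ (x ^+ n.-1)); first by rewrite expf_neq0.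
rewrite -exprSr prednK // xn tofracN mulrN; congr (- _).
rewrite rmorph_sum mulr_sumr; apply: eq_bigr => i _ /=.
rewrite coef_map /= tofracM tofracXn yx mulrCA; congr (_ * _).
have ile : (i <= n.-1)%N by rewrite -ltnS prednK.
by rewrite -{1}(subnK ile) exprD mulrAC exprVn mulfV ?mul1r // expf_neq0.
Qed.

(** * Valuation domains are coherent *)

Lemma valuation_total (D : idomainType) (x y : {fraction D}) :
  valuation_domain D ->
  (exists c, x = c%:F * y) \/ (exists c, y = c%:F * x).
Proof.
move=> vD; have [->|y0] := eqVneq y 0.
  by right; exists 0; rewrite tofrac0 mul0r.
have [->|x0] := eqVneq x 0; first by left; exists 0; rewrite tofrac0 mul0r.
have [|[c _ cE]|[c _ cE]] := vD (x / y); first by rewrite mulf_neq0 ?invr_eq0.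
  by left; exists c; rewrite cE divfK.
by right; exists c; rewrite cE invf_div divfK.
Qed.

(** Adding 0 to the candidates covers the empty family. *)
Lemma valuation_seq_gen (D : idomainType) (s : seq {fraction D}) :
  valuation_domain D ->
  exists2 y, y \in 0 :: s & forall x, x \in s -> exists c, x = c%:F * y.
Proof.
move=> vD; elim: s => [|x s [y ys IHs]]; first by exists 0; rewrite ?mem_head.
have [[c xE]|[c yE]] := valuation_total x y vD.
  exists y; first by move: ys; rewrite !inE => /orP[->|->]; rewrite ?orbT.
  by move=> z; rewrite inE => /predU1P[->|/IHs//]; exists c.
exists x; first by rewrite !inE eqxx orbT.
move=> z; rewrite inE => /predU1P[->|/IHs[d ->]].
  by exists 1; rewrite tofrac1 mul1r.
by exists (d * c); rewrite yE tofracM mulrA.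
Qed.

Lemma valuation_fg_fractional (D : idomainType) (F : set {fraction D}) :
  valuation_domain D -> fg_fractional F ->
  exists y, F = [set x | exists c, x = c%:F * y].
Proof.
move=> vD [s ->]; have [y ys yP] := valuation_seq_gen s vD.
exists y; apply/seteqP; split=> x.
  move=> [c ->]; apply: big_ind => [|_ _ [d ->] [e ->]|i _].
  - by exists 0; rewrite tofrac0 mul0r.
  - by exists (d + e); rewrite tofracD mulrDl.
  - have [d ->] := yP s`_i (mem_nth _ (ltn_ord i)).
    by exists (c i * d); rewrite tofracM mulrA.
move=> [c ->]; move: ys; rewrite inE => /predU1P[->|ys].
  by exists (fun=> 0); rewrite mulr0 big1 // => i _; rewrite tofrac0 mul0r.
have it : (index y s < size s)%N by rewrite index_mem.
exists (fun j => c * (j == index y s)%:R).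
rewrite -{1}(nth_index 0 ys) (@sum_delta _ {fraction D}^o s _ it) mulr_sumr.
by apply: eq_bigr => j _; rewrite tofracM rmorph_nat -mulrA.
Qed.

Lemma valuation_fg_ideal (D : idomainType) (I : set D) :
  valuation_domain D -> fg_ideal I -> exists y, I = principal y.
Proof.
move=> vD /fg_ideal_combE[s ->].
have [y] := @valuation_fg_fractional D _ vD
  (ex_intro _ [seq x%:F | x <- s] erefl).
rewrite size_map => yE.
have inI (c : nat -> D) : (\sum_(i < size s) c i * s`_i)%:F =
    \sum_(i < size s) (c i)%:F * [seq x%:F | x <- s]`_i.
  rewrite rmorph_sum; apply: eq_bigr => i _.
  by rewrite (nth_map 0) // -tofracM.
have [c yc] : exists c : nat -> D, y = (\sum_(i < size s) c i * s`_i)%:F.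
  have : [set x | exists c, x = c%:F * y] y by exists 1; rewrite tofrac1 mul1r.
  by rewrite -yE => -[c cE]; exists c; rewrite inI.
exists (\sum_(i < size s) c i * s`_i); apply/seteqP; split=> x.
  move=> [d dE].
  have : [set x | exists c, x = c%:F * y] x%:F.
    by rewrite -yE; exists d; rewrite dE inI.
  move=> [r]; rewrite yc -tofracM => /eqP; rewrite tofrac_eq => /eqP ->.
  by exists r.
move=> [r _ <-]; exists (fun i => r * c i); rewrite mulr_sumr.
by apply: eq_bigr => i _; rewrite mulrA.
Qed.

(** The presentation is D -> yD, whose kernel is 0 or, when y = 0, all of D. *)
Lemma principal_fp (D : idomainType) (y : D) :
  @fp_submodule D D^o (principal y).
Proof.
exists 1%N, (@comb D D^o 1 (fun=> y)).
have combE k : @comb D D^o 1 (fun=> y) k = k 0 0 * y by rewrite /comb big_ord1.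
split.
  apply/seteqP; split=> x [k _ <-].
    by exists (k 0 0) => //; rewrite -combE.
  by exists (const_mx k) => //; apply: etrans (combE _) _; rewrite mxE.
have [y0|y0] := eqVneq y 0.
  exists [:: const_mx 1]; apply/seteqP; split=> k _; last first.
    by apply: etrans (combE k) _; rewrite y0 mulr0.
  exists (fun=> k 0 0); rewrite big_ord1 /=.
  by apply/rowP => i; rewrite !mxE mulr1 ord1.
exists [::]; apply/seteqP; split=> k.
  move=> /(etrans (esym (combE k))) /eqP.
  rewrite mulf_eq0 (negbTE y0) orbF => /eqP k0.
  by exists (fun=> 0); rewrite big_ord0; apply/rowP => i; rewrite !mxE ord1.
by move=> [c ->]; rewrite big_ord0 /preimage /= raddf0.
Qed.

(** * Valuation domains are t-local *)

(** Of two nonunits one divides the other, hence also divides a u + v. *)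
Lemma valuation_nonunits_ideal (D : idomainType) :
  valuation_domain D -> idealr_closed (mem [set x : D | x \isn't a GRing.unit]).
Proof.
move=> vD; apply/idealr_closedP; split=> /=.
- by rewrite unitr0.
- by rewrite unitr1.
- move=> a u v uN vN.
  have nonunit_mul (c w : D) :
      w \isn't a GRing.unit -> c * w \isn't a GRing.unit.
    by move=> wN; rewrite unitrM (negbTE wN) andbF.
  have [[c]|[c]] := valuation_total u%:F v%:F vD;
    rewrite -tofracM => /eqP; rewrite tofrac_eq => /eqP ->.
    by rewrite mulrA -{2}[v]mul1r -mulrDl; apply: nonunit_mul.
  by rewrite -mulrDl; apply: nonunit_mul.
Qed.

Lemma valuation_local (D : idomainType) : valuation_domain D -> local D.
Proof.
move=> /valuation_nonunits_ideal idN.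
exists [set x : D | x \isn't a GRing.unit]; split.
  split=> // I idI NI; apply/seteqP; split=> // x Ix.
  exact: ideal_nonunit idI Ix.
by move=> M [idM Mmax]; apply: Mmax => // x; apply: ideal_nonunit.
Qed.

(** A finitely generated F inside M is yD for some y in M, and (yD)^v = yD:
    an x in (yD)^v multiplies y^-1, which is in (yD)^-1, into D. *)
Lemma valuation_t_ideal (D : idomainType) (M : set D) :
  valuation_domain D -> idealr_closed (mem M) -> t_ideal (@tofrac D @` M).
Proof.
move=> vD idM; have [M0 _ _] := (idealr_closedP M).1 idM.
rewrite /t_ideal /t_closure; case: asboolP => // Mn0.
pose mults y : set {fraction D} := [set x | exists c : D, x = c%:F * y].
have mults_id y : mults y y by exists 1; rewrite tofrac1 mul1r.
have mults_fg y : fg_fractional (mults y).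
  exists [:: y]; apply/seteqP; split=> x [c ->]; last first.
    by exists (c 0%N); rewrite big_ord1.
  by exists (fun=> c); rewrite big_ord1.
have multsM y : (@tofrac D @` M) y -> mults y `<=` @tofrac D @` M.
  move=> [u Mu <-] _ [c ->]; exists (c * u); rewrite ?tofracM //.
  exact: ideal_mul.
apply/seteqP; split=> x.
  move=> Mx.
  (* when x = 0 any nonzero element of M serves as generator *)
  have [y [My y0 xy]] : exists y, [/\ (@tofrac D @` M) y, y != 0 & mults y x].
    have [x0|x0] := eqVneq x 0; last by exists x.
    apply: contrapT => noy; apply: Mn0; apply/seteqP; split=> y /=.
      move=> My; apply: contrapT => /eqP y0; apply: noy; exists y; split=> //.
      by exists 0; rewrite tofrac0 mul0r.
    by move=> ->; exists 0; rewrite ?tofrac0.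
  have yn0 : mults y <> [set 0].
    by move=> yE; move: (mults_id y); rewrite yE => /eqP; rewrite (negbTE y0).
  exists (mults y); first by split; [apply: multsM| |apply: mults_fg].
  by rewrite /v_closure asboolF // => z zF; rewrite mulrC; apply: zF.
move=> [F [FM Fn0 /(valuation_fg_fractional vD)[y Fy]]].
have y0 : y != 0.
  apply/eqP => y0; apply: Fn0; rewrite Fy y0; apply/seteqP; split=> z /=.
    by move=> [c ->]; rewrite mulr0.
  by move=> ->; exists 0; rewrite mulr0.
rewrite /v_closure asboolF // => xF.
apply: (multsM y); first by apply: FM; rewrite Fy; apply: mults_id.
have [|c _ cE] := xF y^-1; last by exists c; rewrite cE divfK.
by move=> z; rewrite Fy => -[c ->]; exists c; rewrite // mulrCA mulVf ?mulr1.
Qed.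

(** * The equivalence *)

Theorem proposition5p3 (D : idomainType) :
  [<-> valuation_domain D;
       [/\ integrally_closed D, coherent D & t_local D];
       [/\ integrally_closed D, finite_conductor D & t_local D]].
Proof.
tfae.
- move=> vD; split; first exact: valuation_integrally_closed.
    by move=> I /(valuation_fg_ideal vD)[y ->]; apply: principal_fp.
  split; first exact: valuation_local.
  by move=> M [idM _]; apply: valuation_t_ideal.
- by move=> [icD cohD tD]; split=> // a b; apply: coherent_cap_principal_fg.
- by move=> [icD fcD tD]; apply: finite_conductor_t_local_valuation.
Qed.
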